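(* Let $\ast$ be a contour in dimension $\ell$, let $N=N_\ast$ be the associated simple norm on $\mathrm{tame}([0,\infty)^\ell,\mathrm{vec}_K)$, and let $d_N$ be the induced distance on tame functors. Assume $\ast$ is unital. Then, for tame functors $X$ and $Y$, $d_N(X,Y)=0$ if, and only if, $X$ and $Y$ are isomorphic.
   Context: $[0,\infty)^\ell$ is the poset of $\ell$-tuples of non-negative reals with the coordinatewise order; $[0,\infty)^\ell_\infty$ is obtained by adding a global maximum $\infty$. $K$ is a field and $\mathrm{vec}_K$ is the category of finite dimensional $K$-vector spaces. For $v\in[0,\infty)^\ell$, $K(v,-)\colon[0,\infty)^\ell\to\mathrm{vec}_K$ is the functor with $K(v,x)=K$ if $v\le x$ and $0$ otherwise, with identity maps between nonzero values. A functor $X\colon[0,\infty)^\ell\to\mathrm{vec}_K$ is tame if it is finitely presented, i.e. isomorphic to the cokernel of a natural transformation between finite direct sums of functors $K(v,-)$, $v\in[0,\infty)^\ell$. Tame functors form an Abelian category $\mathrm{tame}([0,\infty)^\ell,\mathrm{vec}_K)$. A contour in dimension $\ell$ is a function $\ast\colon[0,\infty)^\ell_\infty\times[0,\infty)\to[0,\infty)^\ell_\infty$ such that: (1) $v\le v\ast t$ for all $v,t$; (2) $v\ast s\le w\ast t$ whenever $v\le w$ and $s\le t$; (3) $(v\ast s)\ast t\le v\ast(s+t)$ for all $v,s,t$; (4) for all $v,w$, the set $\{t\in[0,\infty)\mid v\ast t\ge w\}$ is either empty or of the form $[a,\infty)$ with $a\in[0,\infty)$. The contour is unital if $v\ast0=v$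 for every $v\in[0,\infty)^\ell_\infty$. The norm associated with $\ast$ is $N_\ast(X):=\inf\{t\in[0,\infty)\mid X(v\le v\ast t)=0\text{ for every }v\in[0,\infty)^\ell\text{ with }v\ast t<\infty\}$ for tame $X$ (with $\inf\emptyset=\infty$). For a morphism $f$ of tame functors set $N(f):=N(\ker f)+N(\mathrm{coker}f)$. The induced distance is $d_N(X,Y):=\inf\sum_iN(f_i)$, the infimum over all finite zig-zags $X=W_0\xrightarrow{f_1}W_1\xleftarrow{f_2}W_2\xrightarrow{f_3}\cdots\xleftarrow{f_l}W_l=Y$ of tame functors. *)

(* Defs.v *)
From HB Require Import structures.
From mathcomp Require Import all_boot all_order all_algebra.
From mathcomp Require Import interval_inference.
From mathcomp Require Import all_classical all_reals ereal.

Set Implicit Arguments.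
Unset Strict Implicit.
Unset Printing Implicit Defensive.

Import Order.TTheory GRing.Theory Num.Theory.

Local Open Scope ring_scope.
Local Open Scope classical_set_scope.

(* [None] is the added global maximum, written [\top] through the order       *)
(* structure below.                                                           *)
Definition with_top (T : Type) := option T.

Section WithTop.
Context {d : Order.disp_t} {T : porderType d}.

Definition wt_le (v w : with_top T) : bool :=
  match v, w with
  | _, None => true
  | None, Some _ => false
  | Some x, Some y => (x <= y)%O
  end.

Fact wt_le_refl : reflexive wt_le.
Proof. by case=> [x|] /=. Qed.

Fact wt_le_anti : antisymmetric wt_le.
Proof. by case=> [x|] [y|] //= /le_anti ->. Qed.

Fact wt_le_trans : transitive wt_le.
Proof. by case=> [y|] [x|] [z|] //=; exact: le_trans. Qed.

Fact wt_le_top (v : with_top T) : wt_le v None.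
Proof. by case: v. Qed.

End WithTop.

HB.instance Definition _ (T : choiceType) := Choice.copy (with_top T) (option T).
HB.instance Definition _ (d : Order.disp_t) (T : porderType d) :=
  Order.Le_isPOrder.Build d (with_top T) (@wt_le_refl d T) (@wt_le_anti d T)
    (@wt_le_trans d T).
HB.instance Definition _ (d : Order.disp_t) (T : porderType d) :=
  Order.hasTop.Build d (with_top T) (@wt_le_top d T).

Record pfunctor (d : Order.disp_t) (P : porderType d) (K : fieldType) := PFunctor {
  pobj :> P -> vectType K;
  pmor : forall v w : P, (v <= w)%O -> 'Hom(pobj v, pobj w);
  pmor_id : forall (v : P) (h : (v <= v)%O), pmor h = \1%VF;
  pmor_comp : forall (u v w : P) (h : (u <= v)%O) (h' : (v <= w)%O)
    (h'' : (u <= w)%O), pmor h'' = (pmor h' \o pmor h)%VF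
}.
Arguments pmor {d P K} p {v w} h.

Record nattrans (d : Order.disp_t) (P : porderType d) (K : fieldType)
    (X Y : pfunctor P K) := NatTrans {
  ncomp :> forall v : P, 'Hom(X v, Y v);
  nnat : forall (v w : P) (h : (v <= w)%O),
    (ncomp w \o pmor X h)%VF = (pmor Y h \o ncomp v)%VF
}.

Section Functors.
Context {d : Order.disp_t} {P : porderType d} {K : fieldType}.
Implicit Types X Y Z : pfunctor P K.

Definition isomorphic X Y : Prop :=
  exists (f : nattrans X Y) (g : nattrans Y X),
    (forall v, (g v \o f v)%VF = \1%VF) /\ (forall v, (f v \o g v)%VF = \1%VF).

Section ZeroSum.

Definition zero_functor : pfunctor P K.
Proof.
refine (@PFunctor d P K (fun=> 'rV[K]_0) (fun _ _ _ => \1%VF) _ _) => //.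
by move=> *; rewrite comp_lfun1l.
Defined.

Context (X Y : pfunctor P K).

Definition sum_fun (v w : P) (h : (v <= w)%O) (u : X v * Y v) : X w * Y w :=
  (pmor X h u.1, pmor Y h u.2).

Fact sum_fun_linear v w (h : (v <= w)%O) : linear (sum_fun h).
Proof. by move=> a u u'; rewrite /sum_fun !linearP. Qed.

HB.instance Definition _ v w (h : (v <= w)%O) :=
  GRing.isLinear.Build K (X v * Y v)%type (X w * Y w)%type _ (sum_fun h)
    (sum_fun_linear h).

Definition sum_functor : pfunctor P K.
Proof.
refine (@PFunctor d P K (fun v => (X v * Y v)%type : vectType K)
  (fun v w h => linfun (sum_fun h)) _ _).
- move=> v h; apply/lfunP => -[x y].
  by rewrite lfunE /= /sum_fun /= !pmor_id !lfunE.
- move=> u v w h h' h''; apply/lfunP => -[x y].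
  rewrite comp_lfunE !lfunE /= /sum_fun /=.
  by rewrite !(pmor_comp _ h h' h'') !comp_lfunE.
Defined.

End ZeroSum.

Definition bigsum_functor (s : seq (pfunctor P K)) : pfunctor P K :=
  foldr sum_functor zero_functor s.

(* K(v,-): its value at x is the subspace K or 0 of K, and its maps are       *)
(* induced by the identity of K.                                              *)
Definition free_space (v x : P) : {vspace K^o} :=
  if (v <= x)%O then fullv else 0%VS.

Fact free_space_sub v x y : (x <= y)%O -> (free_space v x <= free_space v y)%VS.
Proof.
rewrite /free_space => xy; case: ifP => [vx|_]; last exact: sub0v.
by rewrite (le_trans vx xy) subvf.
Qed.

Definition free_functor (v : P) : pfunctor P K.
Proof.
refine (@PFunctor d P K (fun x => subvs_of (free_space v x) : vectType K)
  (fun x y _ => (linfun (vsproj (free_space v y)) \o linfun vsval)%VF) _ _).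
- move=> x h; apply/lfunP => u; rewrite comp_lfunE !lfunE.
  exact: vsvalK.
- move=> x y z h h' h''; apply/lfunP => u; rewrite !comp_lfunE !lfunE /=.
  congr (vsproj _ _); rewrite vsprojK //.
  exact: (subvP (free_space_sub v h)) (subvsP u).
Defined.

Section Kernel.
Context (X Y : pfunctor P K) (f : nattrans X Y).

Fact ker_stable v w (h : (v <= w)%O) x :
  x \in lker (f v) -> pmor X h x \in lker (f w).
Proof.
rewrite !memv_ker => /eqP fx0.
by rewrite -comp_lfunE nnat comp_lfunE fx0 linear0.
Qed.

Definition ker_functor : pfunctor P K.
Proof.
refine (@PFunctor d P K (fun v => subvs_of (lker (f v)) : vectType K)
  (fun v w h => (linfun (vsproj (lker (f w))) \o pmor X h \o linfun vsval)%VF)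
  _ _).
- move=> v h; apply/lfunP => u; rewrite !comp_lfunE pmor_id !lfunE.
  exact: vsvalK.
- move=> u v w h h' h''; apply/lfunP => x; rewrite !comp_lfunE !lfunE /=.
  rewrite vsprojK ?(pmor_comp X h h' h'') ?comp_lfunE //.
  exact/ker_stable/subvsP.
Defined.

Definition ker_incl : nattrans ker_functor X.
Proof.
refine (@NatTrans d P K ker_functor X (fun v => linfun vsval) _).
move=> v w h; apply/lfunP => x; rewrite !comp_lfunE !lfunE /= vsprojK //.
exact/ker_stable/subvsP.
Defined.

End Kernel.

Section Cokernel.
Context (X Y : pfunctor P K) (f : nattrans X Y).

(* The quotient of Y v by the image of f v is realized as a complement of     *)
(* that image; [coker_pi v] is the quotient map, the projection along the     *)
(* image (see [coker_pi_ker], [coker_pi_surj], [coker_projP], [coker_functorP]).  *)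
Definition coker_space (v : P) : {vspace Y v} := (limg (f v))^C%VS.

Definition coker_pi (v : P) : 'Hom(Y v, subvs_of (coker_space v)) :=
  (linfun (vsproj (coker_space v)) \o daddv_pi (coker_space v) (limg (f v)))%VF.

Fact coker_cap v : (coker_space v :&: limg (f v) = 0)%VS.
Proof. by rewrite capvC capv_compl. Qed.

Fact coker_decomp v y : exists2 z, z \in limg (f v) &
  y = vsval (coker_pi v y) + z.
Proof.
exists (daddv_pi (limg (f v)) (coker_space v) y); first exact: memv_pi.
rewrite /coker_pi comp_lfunE lfunE /= vsprojK; last exact: memv_pi.
rewrite daddv_pi_add ?coker_cap //.
by rewrite addvC addv_complf memvf.
Qed.

Fact coker_pi_surj v (c : subvs_of (coker_space v)) :
  coker_pi v (vsval c) = c.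
Proof.
rewrite /coker_pi comp_lfunE lfunE /= daddv_pi_id ?coker_cap ?subvsP //.
exact: vsvalK.
Qed.

Fact coker_pi_ker v : lker (coker_pi v) = limg (f v).
Proof.
apply/vspaceP => y; rewrite memv_ker; apply/eqP/idP => [py0|yf].
  by have [z zf ->] := coker_decomp y; rewrite py0 linear0 add0r.
have [z zf yE] := coker_decomp y.
apply/val_inj => /=; apply/eqP; rewrite -memv0 -(coker_cap v) memv_cap subvsP /=.
have -> : vsval (coker_pi v y) = y - z by rewrite {2}yE addrK.
exact: rpredB.
Qed.

Fact coker_stable v w (h : (v <= w)%O) y :
  y \in limg (f v) -> pmor Y h y \in limg (f w).
Proof.
case/memv_imgP => x _ ->; rewrite -comp_lfunE -nnat comp_lfunE.
exact/memv_img/memvf.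
Qed.

Fact coker_nat v w (h : (v <= w)%O) :
  (coker_pi w \o pmor Y h)%VF =
  (coker_pi w \o pmor Y h \o linfun vsval \o coker_pi v)%VF.
Proof.
apply/lfunP => y; have [z zf yE] := coker_decomp y.
transitivity (coker_pi w (pmor Y h y)); first exact: comp_lfunE.
transitivity (coker_pi w (pmor Y h (vsval (coker_pi v y)))); last first.
  by rewrite !comp_lfunE !lfunE.
have /eqP pz0 : coker_pi w (pmor Y h z) == 0.
  by rewrite -memv_ker coker_pi_ker coker_stable.
rewrite {1}yE (linearD (pmor Y h)) (linearD (coker_pi w)).
exact: etrans (congr1 _ pz0) (addr0 _).
Qed.

Definition coker_functor : pfunctor P K.
Proof.
refine (@PFunctor d P K (fun v => subvs_of (coker_space v) : vectType K)
  (fun v w h => (coker_pi w \o pmor Y h \o linfun vsval)%VF) _ _).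
- move=> v h; rewrite pmor_id comp_lfun1r; apply/lfunP => u; rewrite id_lfunE.
  transitivity (coker_pi v (vsval u)); last exact: coker_pi_surj.
  by rewrite comp_lfunE; congr (coker_pi v _); rewrite lfunE.
- move=> u v w h h' h''; rewrite (pmor_comp Y h h' h'').
  transitivity ((coker_pi w \o pmor Y h') \o (pmor Y h \o
    linfun (@vsval _ _ (coker_space u))))%VF.
    by rewrite !comp_lfunA.
  by rewrite [in LHS](coker_nat h') !comp_lfunA.
Defined.

Definition coker_proj : nattrans Y coker_functor.
Proof.
refine (@NatTrans d P K Y coker_functor coker_pi _).
by move=> v w h /=; exact: coker_nat.
Defined.

End Cokernel.

Lemma ker_inclP X Y (f : nattrans X Y) v : (f v \o ker_incl f v)%VF = 0.
Proof.
apply/lfunP => x; rewrite comp_lfunE !lfunE /=; apply/eqP.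
by rewrite -memv_ker subvsP.
Qed.

Lemma ker_functorP X Y Z (f : nattrans X Y) (g : nattrans Z X) :
  (forall v, (f v \o g v)%VF = 0) ->
  exists k : nattrans Z (ker_functor f),
    (forall v, (ker_incl f v \o k v)%VF = g v) /\
    forall k' : nattrans Z (ker_functor f),
      (forall v, (ker_incl f v \o k' v)%VF = g v) -> forall v, k' v = k v.
Proof.
move=> fg0.
have gK v z : g v z \in lker (f v) by rewrite memv_ker -comp_lfunE fg0 lfunE.
pose kc v : 'Hom(Z v, ker_functor f v) :=
  (linfun (vsproj (lker (f v))) \o g v)%VF.
have kE v z : vsval (kc v z) = g v z.
  by rewrite /kc comp_lfunE lfunE /= (vsprojK (gK v z)).
have iE v z : vsval z = ker_incl f v z by rewrite lfunE.
have kn v w (h : (v <= w)%O) :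
    (kc w \o pmor Z h)%VF = (pmor (ker_functor f) h \o kc v)%VF.
  apply/lfunP => z; apply/val_inj; rewrite comp_lfunE [LHS]kE.
  transitivity (pmor X h (g v z)); first by rewrite -!comp_lfunE nnat.
  transitivity ((ker_incl f w \o pmor (ker_functor f) h)%VF (kc v z)).
    by rewrite nnat comp_lfunE -iE kE.
  by rewrite !comp_lfunE -iE.
exists (NatTrans kn); split=> [v|k' k'E v]; apply/lfunP => z.
  by rewrite comp_lfunE -iE [LHS]kE.
by apply/val_inj; rewrite [RHS]kE -k'E comp_lfunE lfunE.
Qed.

Lemma coker_projP X Y (f : nattrans X Y) v : (coker_proj f v \o f v)%VF = 0.
Proof.
apply/lfunP => x; rewrite comp_lfunE [RHS]lfunE /=; apply/eqP.
by rewrite -(memv_ker (coker_pi f v)) coker_pi_ker memv_img ?memvf.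
Qed.

Lemma coker_functorP X Y Z (f : nattrans X Y) (g : nattrans Y Z) :
  (forall v, (g v \o f v)%VF = 0) ->
  exists k : nattrans (coker_functor f) Z,
    (forall v, (k v \o coker_proj f v)%VF = g v) /\
    forall k' : nattrans (coker_functor f) Z,
      (forall v, (k' v \o coker_proj f v)%VF = g v) -> forall v, k' v = k v.
Proof.
move=> gf0.
have gI v y : y \in limg (f v) -> g v y = 0.
  by case/memv_imgP => x _ ->; rewrite -comp_lfunE gf0 lfunE.
pose kc v : 'Hom(coker_functor f v, Z v) := (g v \o linfun vsval)%VF.
have kE v y : kc v (coker_pi f v y) = g v y.
  transitivity (g v (vsval (coker_pi f v y))).
    by rewrite /kc comp_lfunE; congr (g v _); rewrite lfunE.
  have [z /gI zf yE] := coker_decomp f y.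
  by rewrite [in RHS]yE (linearD (g v)); apply/esym/(etrans (congr1 _ zf))/addr0.
have kn v w (h : (v <= w)%O) :
    (kc w \o pmor (coker_functor f) h)%VF = (pmor Z h \o kc v)%VF.
  apply/lfunP => z; rewrite comp_lfunE /=.
  transitivity (kc w (coker_pi f w (pmor Y h (vsval z)))).
    by congr (kc w _); rewrite !comp_lfunE !lfunE.
  by rewrite kE -comp_lfunE nnat !comp_lfunE lfunE.
exists (NatTrans kn); split=> [v|k' k'E v]; apply/lfunP => z.
  by rewrite comp_lfunE; exact: kE.
rewrite -[z]coker_pi_surj; apply/esym; apply: etrans (kE _ _) _.
by rewrite -k'E comp_lfunE.
Qed.

Definition tame (X : pfunctor P K) : Prop :=
  exists (r s : seq P)
    (f : nattrans (bigsum_functor (map free_functor r))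
                  (bigsum_functor (map free_functor s))),
    isomorphic X (coker_functor f).

End Functors.

(* [0,oo)^l with the coordinatewise (product) order of [tupleprod]. *)
Definition orthant (R : realType) (l : nat) : porderType _ :=
  l.-tupleprod {nonneg R}.
Definition eorthant (R : realType) (l : nat) : tPOrderType _ :=
  with_top (orthant R l).

Section Contours.
Context {R : realType} {l : nat}.

Record is_contour (c : eorthant R l -> {nonneg R} -> eorthant R l) : Prop := {
  contour_ge : forall v t, (v <= c v t)%O;
  contour_mono : forall v w (s t : {nonneg R}),
    (v <= w)%O -> s <= t -> (c v s <= c w t)%O;
  contour_action : forall v s t,
    (c (c v s) t <= c v (s%:num + t%:num)%:nng)%O;
  contour_closed : forall v w,
    [set t | (w <= c v t)%O] = set0 \/
    exists a : {nonneg R},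
      [set t | (w <= c v t)%O] = [set t : {nonneg R} | a <= t]
}.

Definition unital (c : eorthant R l -> {nonneg R} -> eorthant R l) : Prop :=
  forall v, c v 0%:nng = v.

Context {K : fieldType} (c : eorthant R l -> {nonneg R} -> eorthant R l).
Implicit Types X Y : pfunctor (orthant R l) K.

(* [c (Some v) t = Some w] says that v * t < oo, with v * t = w. *)
Definition contour_norm X : \bar R :=
  ereal_inf [set (t%:num)%:E | t in [set t : {nonneg R} |
    forall (v w : orthant R l) (h : (v <= w)%O),
      c (Some v) t = Some w -> pmor X h = 0]].

Definition mor_norm X Y (f : nattrans X Y) : \bar R :=
  (contour_norm (ker_functor f) + contour_norm (coker_functor f))%E.

(* X = W_0 -> W_1 <- W_2 -> ... <- W_2n = Y with all the W_i tame. *)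
Inductive zigzag : pfunctor (orthant R l) K -> pfunctor (orthant R l) K -> Type :=
| zigzag_nil X : tame X -> zigzag X X
| zigzag_cons X W Z Y : tame X -> tame W ->
    nattrans X W -> nattrans Z W -> zigzag Z Y -> zigzag X Y.

Fixpoint zigzag_cost X Y (z : zigzag X Y) : \bar R :=
  match z with
  | zigzag_nil _ _ => 0%E
  | zigzag_cons _ _ _ _ _ _ f g z' =>
      (mor_norm f + mor_norm g + zigzag_cost z')%E
  end.

Definition contour_dist X Y : \bar R :=
  ereal_inf [set e | exists z : zigzag X Y, zigzag_cost z = e].

End Contours.

(* Main.v *)
(* A zig-zag of cost less than t induces a natural linear relation between X
   and Y: x and y are related when they are joined by elements of the W_i. Up
   to a shift by t along the contour, this relation is total and injective on
   both sides. Let S be a finite set of grades containing all generators and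
   relations of X and Y. Both functors are constant between comparable points
   that lie above the same elements of S, so they are determined by their
   values on the finite set of joins of subsets of S. Unitality and the
   closedness axiom of contours ensure that for small t the point g * t is
   finite and not separated from g by S, for every such join g. There the
   relation at g * t becomes the graph of an isomorphism. *)

Require Import Defs.
From HB Require Import structures.
From mathcomp Require Import all_boot all_order all_algebra.
From mathcomp Require Import interval_inference.
From mathcomp Require Import lra.
From mathcomp Require Import all_classical all_reals ereal.

Set Implicit Arguments.
Unset Strict Implicit.
Unset Printing Implicit Defensive.

Import Order.TTheory GRing.Theory Num.Theory.

Local Open Scope ring_scope.
Local Open Scope classical_set_scope.

(** Lets a function obtained by choice, whose linearity is only proved afterwards, be used as an
    element of ['Hom(U, V)]. *)
Lemma linear_hom (K : fieldType) (U V : vectType K) (f : U -> V) :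
  linear f -> exists F : 'Hom(U, V), forall x, F x = f x.
Proof.
move=> lf.
pose F : {linear U -> V} := HB.pack f (GRing.isLinear.Build K U V _ f lf).
by exists (linfun F) => x; rewrite lfunE.
Qed.

(** * Natural linear relations between functors *)

Section Relations.
Context {d : Order.disp_t} {P : porderType d} {K : fieldType}.
Implicit Types X Y Z : pfunctor P K.

Lemma pmor_trans X u v w (h : (u <= v)%O) (h' : (v <= w)%O) (h'' : (u <= w)%O) x :
  pmor X h' (pmor X h x) = pmor X h'' x.
Proof. by rewrite (pmor_comp X h h' h'') comp_lfunE. Qed.

Lemma nattransE X Y (f : nattrans X Y) v w (h : (v <= w)%O) x :
  f w (pmor X h x) = pmor Y h (f v x).
Proof. by rewrite -!comp_lfunE nnat. Qed.

Definition linear_rel X Y (rho : forall v, X v -> Y v -> Prop) : Prop :=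
  forall v a x x' y y',
  rho v x y -> rho v x' y' -> rho v (a *: x + x') (a *: y + y').

Definition natural_rel X Y (rho : forall v, X v -> Y v -> Prop) : Prop :=
  forall v w (h : (v <= w)%O) x y,
  rho v x y -> rho w (pmor X h x) (pmor Y h y).

Lemma linear_relB X Y (rho : forall v, X v -> Y v -> Prop) v x x' y y' :
  linear_rel rho -> rho v x y -> rho v x' y' -> rho v (x - x') (y - y').
Proof.
move=> lin xy x'y'; have := lin v (-1) _ _ _ _ x'y' xy.
by rewrite !scaleN1r ![- _ + _]addrC.
Qed.

(** Relating 0 only to 0 makes a linear relation single-valued, so any choice of related elements is
    automatically linear and natural. *)
Lemma nattrans_of_rel X Y (rho : forall v, X v -> Y v -> Prop) :
  linear_rel rho -> natural_rel rho ->
  (forall v x, exists y, rho v x y) -> (forall v y, rho v 0 y -> y = 0) ->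
  exists f : nattrans X Y, forall v x, rho v x (f v x).
Proof.
move=> lin nat tot inj.
have uniq v x y y' : rho v x y -> rho v x y' -> y = y'.
  move=> xy xy'; apply/eqP; rewrite -subr_eq0; apply/eqP/inj.
  by rewrite -(subrr x); exact: linear_relB.
have exF v : exists F : 'Hom(X v, Y v), forall x, rho v x (F x).
  have [f fE] := choice (tot v).
  have /linear_hom[F FE] : linear f.
    by move=> a x y; apply: uniq (fE _) _; exact: lin.
  by exists F => x; rewrite FE.
pose F v := sval (cid (exF v)).
have FE v x : rho v x (F v x) := svalP (cid (exF v)) x.
have Fn v w (h : (v <= w)%O) : (F w \o pmor X h)%VF = (pmor Y h \o F v)%VF.
  apply/lfunP => x; rewrite !comp_lfunE.
  by apply: uniq (FE _ _) _; exact: nat.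
by exists (NatTrans Fn).
Qed.

(** The relation and its converse are both graphs of transformations; injectivity forces the two to
    be mutually inverse. *)
Lemma isomorphic_of_rel X Y (rho : forall v, X v -> Y v -> Prop) :
  linear_rel rho -> natural_rel rho ->
  (forall v x, exists y, rho v x y) -> (forall v y, exists x, rho v x y) ->
  (forall v x, rho v x 0 -> x = 0) -> (forall v y, rho v 0 y -> y = 0) ->
  isomorphic X Y.
Proof.
move=> lin nat totl totr injl injr.
have [f fE] := nattrans_of_rel lin nat totl injr.
have [||g gE] := @nattrans_of_rel Y X (fun v y x => rho v x y) _ _ totr injl.
- by move=> v a x x' y y'; exact: lin.
- by move=> v w h x y; exact: nat.
exists f, g; split=> v; apply/lfunP => x; rewrite comp_lfunE id_lfunE.
  apply/eqP; rewrite -subr_eq0; apply/eqP/injl.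
  by rewrite -(subrr (f v x)); exact: linear_relB.
apply/eqP; rewrite -subr_eq0; apply/eqP/injr.
by rewrite -(subrr (g v x)); exact: linear_relB.
Qed.

End Relations.
Arguments pmor_trans {d P K} X {u v w} h h' h'' x.

Definition id_nattrans (d : Order.disp_t) (P : porderType d) (K : fieldType)
  (X : pfunctor P K) : nattrans X X.
Proof.
by refine (@NatTrans d P K X X (fun=> \1%VF) _) => v w h;
  rewrite comp_lfun1l comp_lfun1r.
Defined.

(** * Constancy of tame functors away from finitely many grades *)

Section Constancy.
Context {d : Order.disp_t} {P : porderType d} {K : fieldType}.
Implicit Types (X Y : pfunctor P K) (S : seq P).

(** For [u <= v] this says that [u] and [v] lie above the same elements of [S]. *)
Definition unseparated S (u v : P) : Prop :=
  forall p, p \in S -> (p <= v)%O -> (p <= u)%O.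

Definition constant_off S X : Prop :=
  forall u v (h : (u <= v)%O), unseparated S u v ->
  (forall x, pmor X h x = 0 -> x = 0) /\ (forall y, exists x, pmor X h x = y).

Lemma constant_off_sub S S' X :
  {subset S <= S'} -> constant_off S X -> constant_off S' X.
Proof. by move=> SS' cX u v h uv; apply: cX => p /SS'; exact: uv. Qed.

Lemma constant_off_iso S X Y :
  isomorphic X Y -> constant_off S Y -> constant_off S X.
Proof.
move=> [f [g [gf fg]]] cY u v h uv; have [inj surj] := cY _ _ h uv.
have gfE w x : g w (f w x) = x by rewrite -comp_lfunE gf id_lfunE.
split=> [x x0|y].
  rewrite -[x]gfE; apply/eqP; rewrite (inj (f u x)) ?linear0 //.
  by rewrite -nattransE x0 linear0.
have [x xE] := surj (f v y).
by exists (g u x); rewrite -nattransE xE gfE.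
Qed.

(** The value of K(p,-) changes only when [p] is crossed, which unseparated points exclude. *)
Lemma constant_off_free S p : p \in S -> constant_off S (free_functor p).
Proof.
move=> pS u v h uv.
(* Elements at different grades are compared inside the common ambient space K, where the structure
   maps act as the identity. *)
pose va w (x : free_functor p w) := vsval (x : subvs_of (@free_space d P K p w)).
have va_inj w : injective (va w) by move=> x y; exact: val_inj.
have hE x : va v (pmor (@free_functor d P K p) h x) = va u x.
  rewrite /va comp_lfunE !lfunE /= vsprojK //.
  exact: (subvP (free_space_sub p h)) (subvsP x).
split=> [x x0|y].
  by apply: va_inj; rewrite -hE x0.
have yu : va v y \in @free_space d P K p u.
  have : va v y \in @free_space d P K p v := subvsP _.
  rewrite /free_space; case: ifP => [pv _|_].
    by rewrite (uv _ pS pv) memvf.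
  by rewrite memv0 => /eqP->; rewrite mem0v.
exists (vsproj _ (va v y)); apply: va_inj; rewrite hE.
exact: vsprojK.
Qed.

Lemma constant_off_sum S X Y :
  constant_off S X -> constant_off S Y -> constant_off S (sum_functor X Y).
Proof.
move=> cX cY u v h uv.
have [[injX surjX] [injY surjY]] := (cX _ _ h uv, cY _ _ h uv).
have hE (x : X u) (y : Y u) :
    pmor (sum_functor X Y) h (x, y) = (pmor X h x, pmor Y h y) by rewrite lfunE.
split=> [[x y]|[x' y']].
  by rewrite hE => -[/injX-> /injY->].
have [[x <-] [y <-]] := (surjX x', surjY y').
by exists (x, y); exact: hE.
Qed.

Lemma constant_off_bigsum S (r : seq P) : {subset r <= S} ->
  constant_off S (bigsum_functor (map (@free_functor d P K) r)).
Proof.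
elim: r => [_ u v h _|p r IH rS].
  by split=> [x _|y]; [|exists 0]; apply/rowP => -[].
apply: constant_off_sum.
  by apply: constant_off_free; apply: rS; rewrite inE eqxx.
by apply: IH => q qr; apply: rS; rewrite inE qr orbT.
Qed.

Lemma coker_functorE X Y (f : nattrans X Y) u v (h : (u <= v)%O) y :
  pmor (coker_functor f) h (coker_proj f u y) = coker_proj f v (pmor Y h y).
Proof. by rewrite nattransE. Qed.

Lemma coker_proj_surj X Y (f : nattrans X Y) v z : exists y, coker_proj f v y = z.
Proof. by exists (vsval z); exact: coker_pi_surj. Qed.

Lemma coker_proj_eq0 X Y (f : nattrans X Y) v y :
  coker_proj f v y = 0 -> exists x, f v x = y.
Proof.
move=> y0; have : y \in limg (f v) by rewrite -coker_pi_ker memv_ker; apply/eqP.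
by case/memv_imgP => x _ ->; exists x.
Qed.

(** A four-lemma chase: if the class of [y] dies at [v], then [y] becomes some [f v x0] there; [x0]
    comes from [u], and injectivity for [Y] puts [y] itself in the image of [f u]. *)
Lemma constant_off_coker S X Y (f : nattrans X Y) :
  constant_off S X -> constant_off S Y -> constant_off S (coker_functor f).
Proof.
move=> cX cY u v h uv.
have [[_ surjX] [injY surjY]] := (cX _ _ h uv, cY _ _ h uv).
split=> [z|z].
  have [y <-] := coker_proj_surj z.
  rewrite coker_functorE => /coker_proj_eq0[x0 x0E].
  have [x xE] := surjX x0.
  have -> : y = f u x.
    apply/eqP; rewrite -subr_eq0; apply/eqP/injY.
    by rewrite linearB /= -nattransE xE x0E subrr.
  by rewrite -comp_lfunE coker_projP lfunE.
have [y0 <-] := coker_proj_surj z; have [y <-] := surjY y0.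
by exists (coker_proj f u y); rewrite coker_functorE.
Qed.

Lemma tame_constant_off X : tame X -> exists S, constant_off S X.
Proof.
move=> [r [s [f /constant_off_iso Xf]]]; exists (r ++ s); apply: Xf.
by apply: constant_off_coker; apply: constant_off_bigsum => p pr;
  rewrite mem_cat pr ?orbT.
Qed.

End Constancy.

(** * Floors in a finite set of joins *)

(** [fl v] is the join of [b] with all elements of [S] below [v]; the least element [b] serves as
    the empty join. *)
Lemma floor_exists (d : Order.disp_t) (P : latticeType d) (b : P) (S : seq P) :
  (forall v, (b <= v)%O) ->
  exists (G : seq P) (fl : P -> P),
    [/\ forall v, fl v \in G,
        forall v, (fl v <= v)%O,
        forall v w, unseparated S w v -> (fl v <= fl w)%O &
        forall v, unseparated S (fl v) v].
Proof.
move=> hb; elim: S => [|p S [G [fl [flG flv flS flu]]]].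
  by exists [:: b], (fun=> b); split=> // v; rewrite inE.
exists (G ++ map (fun g => Order.join p g) G).
exists (fun v => if (p <= v)%O then Order.join p (fl v) else fl v).
split=> [v|v|v w vw|v q].
- by rewrite mem_cat; case: ifP => _; rewrite ?flG // map_f ?orbT.
- by case: ifP => // pv; rewrite leUx pv flv.
- have le_fl : (fl v <= fl w)%O.
    by apply: flS => q qS; apply: vw; rewrite inE qS orbT.
  case: ifP => [pv|_].
    by rewrite vw ?inE ?eqxx // leU2.
  by case: ifP => _ //; apply: le_trans le_fl _; exact: leUr.
- rewrite inE => /orP[/eqP-> ->|qS qv]; first by rewrite leUl.
  have qfl := flu _ _ qS qv.
  by case: ifP => _ //; apply: le_trans qfl _; exact: leUr.
Qed.

(** * Shifts along a contour and vanishing of kernels and cokernels *)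

Section Contours.
Context {R : realType} {l : nat} {K : fieldType}.
Context {c : eorthant R l -> {nonneg R} -> eorthant R l} (hc : is_contour c).
Implicit Types X Y Z : pfunctor (orthant R l) K.

Lemma contour_le v u (t : {nonneg R}) : c (Some v) t = Some u -> (v <= u)%O.
Proof. by move=> vu; have := contour_ge hc (Some v) t; rewrite vu. Qed.

(** The action axiom is only an inequality, hence [u' <= u]; finiteness of the total shift forces
    both intermediate points to be finite. *)
Lemma contour_split v u (s t r : {nonneg R}) : s%:num + t%:num = r%:num ->
  c (Some v) r = Some u -> exists w u',
  [/\ c (Some v) s = Some w, c (Some w) t = Some u' & (u' <= u)%O].
Proof.
move=> str vu; have := contour_action hc (Some v) s t.
have -> : (s%:num + t%:num)%:nng = r by apply/val_inj.
rewrite vu; case: (c (Some v) s) => [w|]; last first.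
  by have := contour_ge hc None t; case: (c None t).
by case wt: (c (Some w) t) => [u'|] // u'u; exists w, u'.
Qed.

Definition vanishes t X : Prop :=
  forall v w (h : (v <= w)%O), c (Some v) t = Some w -> pmor X h = 0.

(** Some [s < t] kills [X], and by monotonicity the map to the shift by [t] factors through the
    shift by [s]. *)
Lemma contour_norm_lt X (t : {nonneg R}) :
  (contour_norm c X < (t%:num)%:E)%E -> vanishes t X.
Proof.
move=> /ereal_inf_lt[_ [s Xs <-]]; rewrite lte_fin => st v w h vw.
have := contour_mono hc (lexx (Some v : eorthant R l)) (ltW st : (s <= t)%O).
rewrite vw; case vw' : (c (Some v) s) => [w'|] // w'w.
rewrite (pmor_comp X (contour_le vw') w'w h) (Xs _ _ _ vw').
by apply/lfunP => x; rewrite comp_lfunE !lfunE linear0.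
Qed.

Lemma contour_norm_ge0 X : (0 <= contour_norm c X)%E.
Proof. by apply: le_ereal_inf_tmp => _ [t _ <-]; rewrite lee_fin. Qed.

Lemma mor_norm_ge0 X Y (f : nattrans X Y) : (0 <= mor_norm c f)%E.
Proof. by rewrite adde_ge0 ?contour_norm_ge0. Qed.

Lemma zigzag_cost_ge0 X Y (z : zigzag X Y) : (0 <= zigzag_cost c z)%E.
Proof.
elim: z => [//|{}X W Z {}Y _ _ f g z z0] /=.
apply: adde_ge0 z0; apply: adde_ge0; exact: mor_norm_ge0.
Qed.

Lemma contour_norm_zero X : (forall v (x : X v), x = 0) -> contour_norm c X = 0%E.
Proof.
move=> X0; apply/le_anti; rewrite contour_norm_ge0 andbT.
apply: ereal_inf_lbound; exists 0%:nng => // v w h _.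
by apply/lfunP => x; rewrite [LHS]X0 [RHS]X0.
Qed.

Lemma mor_norm_bij X Y (f : nattrans X Y) :
  (forall v x, f v x = 0 -> x = 0) -> (forall v y, exists x, f v x = y) ->
  mor_norm c f = 0%E.
Proof.
move=> inj surj; rewrite /mor_norm !contour_norm_zero ?adde0 // => v z.
  have [y <-] := coker_proj_surj z; have [x <-] := surj v y.
  by rewrite -comp_lfunE coker_projP zero_lfunE.
by apply/val_inj/inj; have := subvsP z; rewrite memv_ker => /eqP.
Qed.

Lemma ker_vanishes X Y (f : nattrans X Y) t v u (h : (v <= u)%O) x :
  vanishes t (ker_functor f) -> c (Some v) t = Some u -> f v x = 0 ->
  pmor X h x = 0.
Proof.
move=> ft vu fx0; have xk : x \in lker (f v) by rewrite memv_ker fx0.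
pose k : ker_functor f v := vsproj (lker (f v)) x.
have -> : x = ker_incl f v k by rewrite lfunE /= vsprojK.
by rewrite -nattransE (ft _ _ h vu) zero_lfunE linear0.
Qed.

Lemma coker_vanishes X Y (f : nattrans X Y) t v u (h : (v <= u)%O) y :
  vanishes t (coker_functor f) -> c (Some v) t = Some u ->
  exists x, f u x = pmor Y h y.
Proof.
move=> ft vu; apply: coker_proj_eq0.
by rewrite -coker_functorE (ft _ _ h vu) zero_lfunE.
Qed.

(** * Almost isomorphisms induced by zig-zags *)

(* An isomorphism relation, except that totality and injectivity on either
   side only hold after a shift by [t] along the contour. *)
Record almost_iso_rel (t : {nonneg R}) X Y (rho : forall v, X v -> Y v -> Prop) : Prop := {
  air_linear : linear_rel rho;
  air_natural : natural_rel rho;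
  air_totl : forall v u (h : (v <= u)%O), c (Some v) t = Some u ->
    forall x, exists y, rho u (pmor X h x) y;
  air_totr : forall v u (h : (v <= u)%O), c (Some v) t = Some u ->
    forall y, exists x, rho u x (pmor Y h y);
  air_injl : forall v u (h : (v <= u)%O), c (Some v) t = Some u ->
    forall x, rho v x 0 -> pmor X h x = 0;
  air_injr : forall v u (h : (v <= u)%O), c (Some v) t = Some u ->
    forall y, rho v 0 y -> pmor Y h y = 0
}.

Lemma almost_iso_rel_eq t X : @almost_iso_rel t X X (fun v x y => x = y).
Proof.
split.
- by move=> v a x x' y y' -> ->.
- by move=> v w h x y ->.
- by move=> v u h _ x; exists (pmor X h x).
- by move=> v u h _ x; exists (pmor X h x).
- by move=> v u h _ x ->; exact: linear0.
- by move=> v u h _ x <-; exact: linear0.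
Qed.

(** After a shift by [s], elements of [W] lift along [f] or [g] because cokernels die, and elements
    killed by [f] or [g] vanish because kernels die. Combined with the shift by [t] for [rho], this
    costs [r] in total. *)
Lemma almost_iso_rel_comp (s t r : {nonneg R}) X W Z Y
    (f : nattrans X W) (g : nattrans Z W) (rho : forall v, Z v -> Y v -> Prop) :
  s%:num + t%:num = r%:num ->
  vanishes s (ker_functor f) -> vanishes s (coker_functor f) ->
  vanishes s (ker_functor g) -> vanishes s (coker_functor g) ->
  almost_iso_rel t rho ->
  almost_iso_rel r (fun v x y => exists2 z, f v x = g v z & rho v z y).
Proof.
move=> str kf cf kg cg [lin nat totl totr injl injr].
(* Totality on the right and injectivity on the left shift by [t] first; the other two conditions
   shift by [s] first. *)
have tsr : t%:num + s%:num = r%:num by rewrite addrC.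
have natfg v w (h : (v <= w)%O) x z :
    f v x = g v z -> f w (pmor X h x) = g w (pmor Z h z).
  by rewrite !nattransE => ->.
split.
- move=> v a x x' y y' [z xz zy] [z' xz' zy']; exists (a *: z + z').
    by rewrite [LHS]linearP [RHS]linearP; congr (_ *: _ + _).
  exact: lin.
- by move=> v w h x y [z xz zy]; exists (pmor Z h z); [exact: natfg|exact: nat].
- move=> v u h vu x; have [w [u' [vw wu' u'u]]] := contour_split str vu.
  have [vw' wu1] := (contour_le vw, contour_le wu').
  have [z zE] := coker_vanishes vw' (f v x) cg vw.
  have [y zy] := totl _ _ wu1 wu' z.
  exists (pmor Y u'u y); exists (pmor Z u'u (pmor Z wu1 z)); last exact: nat.
  rewrite (pmor_trans Z wu1 u'u (le_trans wu1 u'u)).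
  by rewrite -(pmor_trans X vw' (le_trans wu1 u'u) h) !nattransE zE.
- move=> v u h vu y; have [w [u' [vw wu' u'u]]] := contour_split tsr vu.
  have [vw' wu1] := (contour_le vw, contour_le wu').
  have [z zy] := totr _ _ vw' vw y.
  have [x xE] := coker_vanishes wu1 (g w z) cf wu'.
  exists (pmor X u'u x); exists (pmor Z u'u (pmor Z wu1 z)).
    by rewrite !nattransE xE.
  rewrite (pmor_trans Z wu1 u'u (le_trans wu1 u'u)).
  by rewrite -(pmor_trans Y vw' (le_trans wu1 u'u) h); exact: nat.
- move=> v u h vu x [z xz z0]; have [w [u' [vw wu' u'u]]] := contour_split tsr vu.
  have [vw' wu1] := (contour_le vw, contour_le wu').
  rewrite -(pmor_trans X (le_trans vw' wu1) u'u h) -(pmor_trans X vw' wu1).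
  rewrite (ker_vanishes _ kf wu') ?linear0 //.
  by rewrite (natfg _ _ _ _ _ xz) (injl _ _ _ vw _ z0) linear0.
- move=> v u h vu y [z xz zy]; have [w [u' [vw wu' u'u]]] := contour_split str vu.
  have [vw' wu1] := (contour_le vw, contour_le wu').
  rewrite -(pmor_trans Y (le_trans vw' wu1) u'u h) -(pmor_trans Y vw' wu1).
  rewrite (injr _ _ _ wu') ?linear0 //.
  rewrite -(ker_vanishes vw' kg vw (_ : g v z = 0)); first exact: nat.
  by rewrite -xz linear0.
Qed.

(** Half of the slack [r - (a + b)] goes to each summand, so both inequalities stay strict. *)
Lemma nonneg_split (a b : \bar R) (r : {nonneg R}) :
  (0 <= a)%E -> (0 <= b)%E -> (a + b < (r%:num)%:E)%E ->
  exists s t : {nonneg R}, [/\ s%:num + t%:num = r%:num,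
    (a < (s%:num)%:E)%E & (b < (t%:num)%:E)%E].
Proof.
case: a b => [a||] [b||] //; rewrite !lee_fin -EFinD lte_fin => a0 b0 abr.
have e0 : 0 <= (r%:num - (a + b)) / 2 by rewrite divr_ge0 // subr_ge0 ltW.
exists (NngNum (addr_ge0 a0 e0)), (NngNum (addr_ge0 b0 e0)) => /=.
have e1 : 0 < (r%:num - (a + b)) / 2 by rewrite divr_gt0 // subr_gt0.
split; rewrite ?lte_fin ?ltrDl //.
by rewrite addrACA -splitr addrC subrK.
Qed.

(** Induction on the zig-zag, splitting [r] into a part [s] for the first two arrows and a part for
    the rest. Norms are nonnegative, so each kernel and cokernel of these arrows has norm below
    [s]. *)
Lemma zigzag_almost_iso X Y (z : zigzag X Y) (r : {nonneg R}) :
  (zigzag_cost c z < (r%:num)%:E)%E -> exists rho, @almost_iso_rel r X Y rho.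
Proof.
elim: z r => [{}X _|{}X W Z {}Y _ _ f g z IH] r /=.
  by exists (fun v x y => x = y); exact: almost_iso_rel_eq.
have [f0 g0] := (mor_norm_ge0 f, mor_norm_ge0 g).
move=> /nonneg_split[||s [t [str fgs /IH[rho zt]]]].
- exact: (adde_ge0 f0 g0).
- exact: zigzag_cost_ge0.
have fs : (mor_norm c f < (s%:num)%:E)%E.
  exact: le_lt_trans (leeDl _ g0) fgs.
have gs : (mor_norm c g < (s%:num)%:E)%E.
  exact: le_lt_trans (leeDr _ f0) fgs.
have van A B (h : nattrans A B) : (mor_norm c h < (s%:num)%:E)%E ->
    vanishes s (ker_functor h) /\ vanishes s (coker_functor h).
  by move=> hs; split; apply: contour_norm_lt; apply: le_lt_trans hs;
    [apply: leeDl|apply: leeDr]; exact: contour_norm_ge0.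
have [[kf cf] [kg cg]] := (van _ _ f fs, van _ _ g gs).
by eexists; exact: almost_iso_rel_comp str kf cf kg cg zt.
Qed.

(** * Small shifts cross no grade of a finite set *)

(** The times at which [w] is reached form the empty set or some [a,oo). If a were 0, unitality
    would give [w <= v]; so a is a positive bound. *)
Lemma contour_small_pair v w : unital c -> ~~ (w <= v)%O ->
  exists2 e : R, 0 < e & forall t : {nonneg R}, t%:num < e -> ~~ (w <= c v t)%O.
Proof.
move=> hu wv; have mem t : (w <= c v t)%O = ([set t | (w <= c v t)%O] t) :> Prop by [].
have [E0|[a Ea]] := contour_closed hc v w.
  by exists 1 => // t _; apply/negP; rewrite mem E0.
exists a%:num => [|t ta]; last first.
  by apply/negP; rewrite mem Ea /= => /le_lt_trans/(_ ta); rewrite ltxx.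
rewrite lt_neqAle [X in _ && X]ge0 andbT eq_sym; apply: contra wv => /eqP a0.
rewrite -[v]hu; have : [set t : {nonneg R} | (a <= t)%O] 0%:nng.
  by rewrite /= -num_le /= a0.
by rewrite -Ea.
Qed.

Lemma contour_small_pairs (L : seq (eorthant R l * eorthant R l)) :
  unital c ->
  exists2 e : R, 0 < e & forall v w, (v, w) \in L -> ~~ (w <= v)%O ->
    forall t : {nonneg R}, t%:num < e -> ~~ (w <= c v t)%O.
Proof.
move=> hu; elim: L => [|[v w] L [e e0 eL]]; first by exists 1.
have [wv|/(contour_small_pair hu)[e' e'0 e'L]] := boolP (w <= v)%O.
  exists e => // v' w'; rewrite inE => /orP[/eqP[-> ->]|]; first by rewrite wv.
  exact: eL.
exists (Num.min e e'); first by rewrite lt_min e0.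
move=> v' w'; rewrite inE => vw w'v' t; rewrite lt_min => /andP[te te'].
by case/orP: vw => [/eqP[-> ->]|vw]; [exact: e'L|exact: eL te].
Qed.

Lemma contour_small (G S : seq (orthant R l)) : unital c ->
  exists2 e : R, 0 < e & forall g, g \in G ->
    forall t : {nonneg R}, t%:num < e ->
    exists2 u, c (Some g) t = Some u & unseparated S g u.
Proof.
(* Not reaching the added [None] is exactly finiteness of the shifted point. *)
pose S' : seq (eorthant R l) := None :: map Some S.
move=> hu; have [e e0 eL] := contour_small_pairs
  [seq (Some g : eorthant R l, w) | g <- G, w <- S'] hu.
exists e => // g gG t te.
have sep (w : eorthant R l) : w \in S' -> (w <= c (Some g) t)%O -> (w <= (Some g : eorthant R l))%O.
  move=> wS; apply: contraLR => wg; apply: eL wg _ te.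
  by apply/allpairsP; exists (g, w).
case gu : (c (Some g) t) sep => [u|] sep; last first.
  by have := sep None; rewrite inE eqxx => /(_ isT isT).
exists u => // p pS pu; apply: (sep (Some p)) pu.
by rewrite inE map_f.
Qed.

(** * From an almost isomorphism to an isomorphism *)

(** [X] and [Y] at [v] are identified with their values at [fl v], and [rho] is read off at [fl v]
    shifted by [t], where both functors are still unchanged. *)
Lemma isomorphic_of_almost_iso (S G : seq (orthant R l))
    (fl : orthant R l -> orthant R l) (e : R) (t : {nonneg R}) X Y rho :
  (forall v, fl v \in G) -> (forall v, (fl v <= v)%O) ->
  (forall v w, unseparated S w v -> (fl v <= fl w)%O) ->
  (forall v, unseparated S (fl v) v) ->
  (forall g, g \in G -> forall t : {nonneg R}, t%:num < e ->
    exists2 u, c (Some g) t = Some u & unseparated S g u) ->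
  constant_off S X -> constant_off S Y -> t%:num + t%:num < e ->
  @almost_iso_rel t X Y rho -> isomorphic X Y.
Proof.
move=> flG fl_le fl_mono fl_sep small cX cY tte [lin nat totl totr injl injr].
have te : t%:num < e by apply: le_lt_trans tte; rewrite lerDl.
have [t2 ttt2] : exists t2 : {nonneg R}, t%:num + t%:num = t2%:num.
  by exists (t%:num + t%:num)%:nng.
rewrite ttt2 in tte.
have bijX v := cX _ _ (fl_le v) (fl_sep v).
have bijY v := cY _ _ (fl_le v) (fl_sep v).
have shift v : exists2 u, c (Some (fl v)) t = Some u & unseparated S (fl v) u.
  exact: small.
(* Injectivity of [rho] at the shifted point costs a second [t]; the doubly shifted point lies below
   some [w'] not separated from [fl v], since [t + t < e]. *)
have shift2 v : exists u w w', [/\ c (Some (fl v)) t = Some u,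
    c (Some u) t = Some w, (w <= w')%O & unseparated S (fl v) w'].
  have [w' vw' sepw'] := small _ (flG v) t2 tte.
  by have [u [w [vu uw ww']]] := contour_split ttt2 vw'; exists u, w, w'.
apply: (@isomorphic_of_rel _ _ _ X Y (fun v x y => exists x0 y0,
  [/\ pmor X (fl_le v) x0 = x, pmor Y (fl_le v) y0 = y &
    forall u (h : (fl v <= u)%O), c (Some (fl v)) t = Some u ->
      rho u (pmor X h x0) (pmor Y h y0)])).
- move=> v a x x' y y' [x0 [y0 [<- <- xy]]] [x0' [y0' [<- <- xy']]].
  exists (a *: x0 + x0'), (a *: y0 + y0'); rewrite !linearP; split=> // u h vu.
  by rewrite !linearP; apply: lin; [exact: xy|exact: xy'].
- move=> v w h x y [x0 [y0 [<- <- xy]]].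
  have flvw : (fl v <= fl w)%O.
    by apply: fl_mono => p pS /le_trans; apply.
  have flvw' := le_trans (fl_le v) h.
  exists (pmor X flvw x0), (pmor Y flvw y0); split.
  + by rewrite !(pmor_trans _ _ _ flvw').
  + by rewrite !(pmor_trans _ _ _ flvw').
  move=> u' wu' flwu'; have [u flvu _] := shift v.
  (* Monotonicity of the contour lets naturality of [rho] carry the relation from the shift of
     [fl v] to that of [fl w]. *)
  have uu' : (u <= u')%O.
    have flvw_top : (Some (fl v) <= Some (fl w) :> eorthant R l)%O := flvw.
    by have := contour_mono hc flvw_top (lexx t); rewrite flvu flwu'.
  have vu := contour_le flvu; have := nat _ _ uu' _ _ (xy _ vu flvu).
  by rewrite !(pmor_trans _ _ _ (le_trans vu uu')).
(* [rho] supplies a partner at the shifted point, and constancy of [Y] brings it back to [fl v]. *)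
- move=> v x; have [x0 <-] := (bijX v).2 x; have [u vu sepu] := shift v.
  have [y xy] := totl _ _ (contour_le vu) vu x0.
  have [y0 y0E] := (cY _ _ (contour_le vu) sepu).2 y.
  exists (pmor Y (fl_le v) y0), x0, y0; split=> // u' h; rewrite vu => -[uu'].
  by case: u' / uu' h => h; rewrite (bool_irrelevance h (contour_le vu)) y0E.
- move=> v y; have [y0 <-] := (bijY v).2 y; have [u vu sepu] := shift v.
  have [x xy] := totr _ _ (contour_le vu) vu y0.
  have [x0 x0E] := (cX _ _ (contour_le vu) sepu).2 x.
  exists (pmor X (fl_le v) x0), x0, y0; split=> // u' h; rewrite vu => -[uu'].
  by case: u' / uu' h => h; rewrite (bool_irrelevance h (contour_le vu)) x0E.
(* Here [y0 = 0], so the image of [x0] dies after the second shift; the map of [X] from [fl v] to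
   [w'] is injective, hence [x0 = 0]. *)
- move=> v x [x0 [y0 [<- /(bijY v).1-> xy]]].
  have [u [w [w' [vu uw ww' sepw']]]] := shift2 v.
  have [vu' uw1] := (contour_le vu, contour_le uw).
  have vw' := le_trans (le_trans vu' uw1) ww'.
  have := xy _ vu' vu; rewrite linear0 => /(injl _ _ uw1 uw) x0w.
  rewrite ((cX _ _ vw' sepw').1 x0) ?linear0 //.
  rewrite -(pmor_trans X (le_trans vu' uw1) ww') -(pmor_trans X vu' uw1) x0w.
  exact: linear0.
- move=> v y [x0 [y0 [/(bijX v).1-> <- xy]]].
  have [u [w [w' [vu uw ww' sepw']]]] := shift2 v.
  have [vu' uw1] := (contour_le vu, contour_le uw).
  have vw' := le_trans (le_trans vu' uw1) ww'.
  have := xy _ vu' vu; rewrite linear0 => /(injr _ _ uw1 uw) y0w.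
  rewrite ((cY _ _ vw' sepw').1 y0) ?linear0 //.
  rewrite -(pmor_trans Y (le_trans vu' uw1) ww') -(pmor_trans Y vu' uw1) y0w.
  exact: linear0.
Qed.

End Contours.

(** * Distance zero and isomorphism *)

Theorem proposition8p3 (R : realType) (l : nat) (K : fieldType)
    (c : eorthant R l -> {nonneg R} -> eorthant R l)
    (hc : is_contour c) (hu : unital c)
    (X Y : pfunctor (orthant R l) K) (hX : tame X) (hY : tame Y) :
  contour_dist c X Y = 0%E <-> isomorphic X Y.
Proof.
split=> [XY0|XY].
  have [[SX cX] [SY cY]] := (tame_constant_off hX, tame_constant_off hY).
  pose S := SX ++ SY.
  have {}cX : constant_off S X.
    by apply: constant_off_sub cX => p pX; rewrite mem_cat pX.
  have {}cY : constant_off S Y.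
    by apply: constant_off_sub cY => p pY; rewrite mem_cat pY orbT.
  have [b b_le] : exists b : l.-tupleprod {nonneg R}, forall v, (b <= v)%O.
    exists [tuple of nseq l 0%:nng] => v.
    by rewrite leEtprod; apply/forallP => i; rewrite tnth_nseq -num_le /=.
  have [G [fl [flG fl_le fl_mono fl_sep]]] := floor_exists S b_le.
  have [e e0 small] := contour_small hc G S hu.
  (* A third of [e] keeps the double shift [t + t] strictly below [e]. *)
  have t0 : 0 < e / 3 by rewrite divr_gt0.
  have [t tE] : exists t : {nonneg R}, t%:num = e / 3 by exists (NngNum (ltW t0)).
  have : (contour_dist c X Y < (t%:num)%:E)%E by rewrite XY0 lte_fin tE.
  move=> /ereal_inf_lt[_ [z <-] /(zigzag_almost_iso hc)[rho]].
  apply: (isomorphic_of_almost_iso hc flG fl_le fl_mono fl_sep small cX cY).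
  by rewrite tE; lra.
apply/le_anti/andP; split; last first.
  by apply: le_ereal_inf_tmp => _ [z <-]; exact: zigzag_cost_ge0.
have [f [g [gf fg]]] := XY.
(* The zig-zag X -> Y <- Y given by [f] and the identity has cost 0, as both arrows are bijective at
   every grade. *)
apply: ereal_inf_lbound; exists (zigzag_cons hX hY f (id_nattrans Y) (zigzag_nil hY)).
rewrite /= !mor_norm_bij ?adde0 // => v x.
- by rewrite id_lfunE.
- by exists x; rewrite id_lfunE.
- by move=> fx0; rewrite -[x]id_lfunE -(gf v) comp_lfunE fx0 linear0.
- by exists (g v x); rewrite -comp_lfunE fg id_lfunE.
Qed.
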